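(* The Cantor fan is embeddable into the Lelek fan. That is, if $X$ is a Cantor fan and $L$ is a Lelek fan, then there exists a topological embedding $X \to L$ (a continuous map that is a homeomorphism onto its image).
   Context: A continuum is a non-empty compact connected metric space; a subcontinuum is a subspace of a continuum which is itself a continuum. An arc is a space homeomorphic to $[0,1]$. A Cantor set is a space homeomorphic to the standard middle-third Cantor set. A continuum $X$ is a Cantor fan if $X$ is homeomorphic to the continuum $\bigcup_{c\in C}A_c$, where $C\subseteq[0,1]$ is a Cantor set and for each $c\in C$, $A_c$ is the convex segment in the plane from $(0,0)$ to $(c,-1)$. Let $X$ be a Cantor fan and let $Y$ be a subcontinuum of $X$. A point $x\in Y$ is an end-point of $Y$ if for every arc $A$ in $Y$ that contains $x$, $x$ is an end-point of $A$. The set of all end-points of $Y$ is denoted by $E(Y)$. A non-degenerate (i.e. having more than one point) subcontinuum $Y$ of a Cantor fan $X$ is a Lelek fan if $\operatorname{Cl}(E(Y))=Y$, where the closure is taken in $Y$. A continuum homeomorphic to such a $Y$ is also called a Lelek fan. (Any two Lelek fans are homeomorphic, which justifies speaking of ''the'' Lelek fan; likewise for ''the'' Cantor fan.) *)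

(* Defs.v *)
From HB Require Import structures.
From mathcomp Require Import all_boot all_order all_algebra.
From mathcomp Require Import all_classical all_reals all_analysis.

Set Implicit Arguments.
Unset Strict Implicit.
Unset Printing Implicit Defensive.

Import Order.TTheory GRing.Theory Num.Theory.
Import numFieldNormedType.Exports.

Local Open Scope classical_set_scope.
Local Open Scope ring_scope.

(* A set [A : set T] used as a type is [set_type A], which carries the
   topology induced by [T]. *)

Definition homeomorphism (S T : topologicalType) (f : S -> T) : Prop :=
  continuous f /\ exists g : T -> S, [/\ continuous g, cancel f g & cancel g f].

Definition homeomorphic (S T : topologicalType) : Prop :=
  exists f : S -> T, homeomorphism f.

(* [h] is [f] with its codomain restricted to the image of [f]. *)
Definition embedding (S T : topologicalType) (f : S -> T) : Prop :=
  continuous f /\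
  exists h : S -> range f, (forall x, set_val (h x) = f x) /\ homeomorphism h.

(* A subspace of a metric space [T] is represented by a set, the whole space
   being [[set: T]]; thus a subcontinuum of [T] is a [Y : set T] such that
   [continuum Y]. *)
Definition continuum (R : realType) (T : metricType R) (A : set T) : Prop :=
  [/\ A !=set0, compact A & connected A].

Definition unit_interval (R : realType) : set R := `[0, 1].
Arguments unit_interval R : clear implicits.

Definition arc (R : realType) (T : topologicalType) (A : set T) : Prop :=
  homeomorphic (unit_interval R) A.

(* The end-points of an arc are the images of 0 and 1 under a homeomorphism
   from [0, 1]; they do not depend on the homeomorphism. *)
Definition arc_end_point (R : realType) (T : topologicalType) (A : set T)
    (x : T) : Prop :=
  exists h : unit_interval R -> A, homeomorphism h /\
  exists t : unit_interval R,
    (set_val t = 0 \/ set_val t = 1) /\ set_val (h t) = x.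

Definition end_points (R : realType) (T : topologicalType) : set T :=
  [set x | forall A : set T, arc R A -> A x -> arc_end_point R A x].
Arguments end_points R T : clear implicits.

Fixpoint middle_third_step (R : realType) (n : nat) : set R :=
  if n is m.+1 then
    [set x / 3 | x in middle_third_step m] `|`
    [set (x + 2) / 3 | x in middle_third_step m]
  else `[0, 1].
Arguments middle_third_step R n : clear implicits.

Definition middle_third_set (R : realType) : set R :=
  \bigcap_n middle_third_step R n.
Arguments middle_third_set R : clear implicits.

Definition cantor_set (R : realType) (T : topologicalType) : Prop :=
  homeomorphic T (middle_third_set R).

Definition plane_segment (R : realType) (p q : R * R) : set (R * R) :=
  [set ((1 - t) * p.1 + t * q.1, (1 - t) * p.2 + t * q.2) | t in `[0, 1]].

Definition fan_over (R : realType) (C : set R) : set (R * R) :=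
  \bigcup_(c in C) plane_segment (0, 0) (c, -1).

Definition cantor_fan (R : realType) (X : metricType R) : Prop :=
  continuum [set: X] /\
  exists C : set R,
    [/\ C `<=` `[0, 1], cantor_set R C & homeomorphic X (fan_over C)].

(* [end_points R Y] is a set of points of the subspace [Y], so its closure is
   taken in [Y]. *)
Definition lelek_subcontinuum (R : realType) (X : metricType R) (Y : set X)
    : Prop :=
  [/\ continuum Y,
      exists x y, [/\ Y x, Y y & x <> y] &
      closure (end_points R Y) = [set: Y]].

Definition lelek_fan (R : realType) (L : metricType R) : Prop :=
  continuum [set: L] /\
  exists (X : metricType R) (Y : set X),
    [/\ cantor_fan X, lelek_subcontinuum Y & homeomorphic L Y].

(* Main.v *)
Require Import Defs.
From HB Require Import structures.
From mathcomp Require Import all_boot all_order all_algebra.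
From mathcomp Require Import all_classical all_reals all_analysis.
From mathcomp Require Import ring lra.

(* Realize the Lelek fan as a subcontinuum Z of the fan over a Cantor set C.
   Since C is totally disconnected and Z is connected, Z meets every leg in a
   segment issued from the vertex, so an end-point of Z other than the vertex is
   the tip of its leg. As the tips are dense, for small d the set P of those c
   whose leg in Z is longer than d has no isolated point: a point in the middle
   of the part of the leg of c beyond d is a limit of tips, and these lie on
   other legs. The closure of P is thus a Cantor set over which all legs reach
   length d, and the fan of height d over it lies in Z. *)

Set Implicit Arguments.
Unset Strict Implicit.
Unset Printing Implicit Defensive.

Import Order.TTheory GRing.Theory Num.Theory.
Import numFieldNormedType.Exports.

Local Open Scope classical_set_scope.
Local Open Scope ring_scope.

(** * Subspaces, embeddings of compact spaces, and clamping to an interval *)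

Lemma set_val_continuous (T : topologicalType) (A : set T) :
  continuous (set_val : A -> T).
Proof. exact: initial_continuous. Qed.

Lemma set_val_inj (T : Type) (A : set T) : injective (set_val : A -> T).
Proof. by move=> x y xy; apply/val_inj. Qed.

Lemma range_set_val (S T : Type) (f : S -> T) (y : range f) :
  exists x, f x = set_val y.
Proof. by have [x _ xy] := set_valP y; exists x. Qed.

Definition to_set_type (T : Type) (A : set T) (x : T) (Ax : A x) : A :=
  exist _ x (mem_set Ax).

Definition corestrict (S T : Type) (A : set T) (f : S -> T)
  (fA : forall x, A (f x)) (x : S) : A := to_set_type (fA x).

Lemma corestrictE (S T : Type) (A : set T) (f : S -> T)
  (fA : forall x, A (f x)) x : set_val (corestrict fA x) = f x.
Proof. by []. Qed.

Lemma continuous_corestrict (S T : topologicalType) (A : set T) (f : S -> T)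
  (fA : forall x, A (f x)) : continuous f -> continuous (corestrict fA).
Proof. by move=> cf; apply: continuous_comp_initial. Qed.

Lemma compact_set_type (T : topologicalType) (A : set T) :
  compact A -> compact [set: A].
Proof.
move=> cA F PF _.
have [|x [Ax Fx]] := cA (set_val @ F) _.
  by apply: (@filterS _ F _ setT); [move=> x _ /=; exact: set_valP|exact: filterT].
exists (to_set_type Ax); split=> // U V FU /= [_ [[W oW <-] /= Wx WV]].
have [z [[u Uu <-] Wu]] : (set_val @` U) `&` W !=set0.
  apply: Fx; last exact: open_nbhs_nbhs.
  by apply: (@filterS _ F _ U) => // u Uu; exists u.
by exists u; split=> //; exact: WV.
Qed.

Lemma hausdorff_injective (S T : topologicalType) (f : S -> T) :
  hausdorff_space T -> continuous f -> injective f -> hausdorff_space S.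
Proof.
move=> hT cf fI x y xy; apply/fI/hT => U V /cf Ux /cf Vy.
by have [z [Uz Vz]] := xy _ _ Ux Vy; exists (f z).
Qed.

Lemma hausdorff_set_type (T : topologicalType) (A : set T) :
  hausdorff_space T -> hausdorff_space A.
Proof.
move=> hT; apply: (hausdorff_injective hT (@set_val_continuous _ A)).
exact: set_val_inj.
Qed.

Lemma compact_bijective_homeomorphism (S T : topologicalType) (f : S -> T)
    (g : T -> S) :
  compact [set: S] -> hausdorff_space T -> continuous f -> cancel f g ->
  cancel g f -> homeomorphism f.
Proof.
move=> cS hT cf fK gK; split=> //; exists g; split=> //.
apply/continuous_closedP => C cC.
have -> : g @^-1` C = f @` C.
  apply/seteqP; split=> y /=; first by move=> Cgy; exists (g y).
  by move=> [x Cx <-]; rewrite fK.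
apply: compact_closed => //; apply: continuous_compact.
  exact: continuous_subspaceT.
exact: subclosed_compact cC cS _.
Qed.

Lemma compact_injective_embedding (S T : topologicalType) (f : S -> T) :
  compact [set: S] -> hausdorff_space T -> continuous f -> injective f ->
  embedding f.
Proof.
move=> cS hT cf fI; split=> //.
have fr x : range f (f x) by exists x.
exists (corestrict fr); split=> //.
have [g gE] := choice (@range_set_val _ _ f).
apply: (@compact_bijective_homeomorphism _ _ _ g) => //.
- exact: hausdorff_set_type.
- exact: continuous_corestrict.
- by move=> x; apply: fI; exact: gE.
- by move=> y; apply: set_val_inj; exact: gE.
Qed.

Lemma homeomorphism_injective (S T : topologicalType) (f : S -> T) :
  homeomorphism f -> injective f.
Proof. by move=> [_ [g [_ fK _]]]; exact: can_inj fK. Qed.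

(** For [a <= b], the retraction of the line onto [[a, b]]. Precomposing with it makes a map given
    on an interval total, so that the intermediate value theorem applies. *)
Definition clamp (R : realType) (a b : R) (x : R) : R :=
  Num.max a (Num.min b x).

Lemma clamp_itv (R : realType) (a b x : R) : a <= b -> `[a, b]%classic (clamp a b x).
Proof.
move=> ab; rewrite /= in_itv/= /clamp le_max lexx/= ge_max ab/=.
by rewrite ge_min lexx.
Qed.

Lemma clamp_id (R : realType) (a b x : R) : a <= x <= b -> clamp a b x = x.
Proof.
by move=> /andP[ax xb]; rewrite /clamp (min_idPr xb) (max_idPr ax).
Qed.

Lemma continuous_clamp (R : realType) (a b : R) : continuous (clamp a b).
Proof.
move=> x; apply: (@continuous_max _ R^o); first exact: cvg_cst.
by apply: (@continuous_min _ R^o); [exact: cvg_cst|exact: cvg_id].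
Qed.

(** * Compactness and gaps of Cantor sets in the line *)

Section Cantor_sets_of_reals.
Variable R : realType.

(** The point 1/2 is missing from every step after step 0, so an interval inside such a step lies on
    one side of it, and rescaling by 3 puts it inside the preceding step. *)
Lemma middle_third_step_gap n (x y : R) :
  `[x, y] `<=` middle_third_step R n -> (y - x) * 3 ^+ n <= 1.
Proof.
elim: n x y => [|n ih] x y xyM.
  have [xy|yx] := leP x y; last by rewrite expr0; lra.
  have /= := xyM x; rewrite !in_itv /= lexx xy => /(_ isT) x01.
  have /= := xyM y; rewrite !in_itv /= lexx xy => /(_ isT) y01.
  by rewrite expr0; lra.
have step01 m (z : R) : middle_third_step R m z -> 0 <= z <= 1.
  elim: m z => [|m ihm] z; first by rewrite /= in_itv.
  by case=> -[w /ihm w01 <-]; lra.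
rewrite exprS mulrA.
have [y2|y2] := ltP y 2^-1.
  have -> : (y - x) * 3 = y * 3 - x * 3 by ring.
  apply: ih => z; rewrite /= in_itv/= => xzy.
  have : middle_third_step R n.+1 (z / 3) by apply: xyM; rewrite /= in_itv/=; lra.
  by case=> -[w wM wz]; have := step01 _ _ wM => w01; [have -> : z = w by lra|lra].
have [x2|x2] := ltP 2^-1 x.
  have -> : (y - x) * 3 = (y * 3 - 2) - (x * 3 - 2) by ring.
  apply: ih => z; rewrite /= in_itv/= => xzy.
  have : middle_third_step R n.+1 ((z + 2) / 3).
    by apply: xyM; rewrite /= in_itv/=; lra.
  by case=> -[w wM wz]; have := step01 _ _ wM => w01; [lra|have -> : z = w by lra].
have : middle_third_step R n.+1 2^-1 by apply: xyM; rewrite /= in_itv/= x2.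
by case=> -[w /step01 w01 wz]; lra.
Qed.

(** For sets of reals this amounts to total disconnectedness. The missing points serve as places to
    cut [A] into clopen pieces. *)
Definition gapped (A : set R) := forall x y, x < y -> exists2 q, x < q < y & ~ A q.

Lemma middle_third_gapped : gapped (middle_third_set R).
Proof.
move=> x y xy; apply: contrapT => nq.
(* The contrary assumption only covers points strictly between [x] and [y], hence a closed interval
   further inside. *)
pose x' := x + (y - x) / 3; pose y' := x + (y - x) * 2 / 3.
have xyM : `[x', y'] `<=` middle_third_set R.
  move=> z; rewrite /= in_itv/= /x' /y' => xzy; apply: contrapT => nz.
  by apply: nq; exists z => //; lra.
have d0 : 0 < y' - x' by rewrite /x' /y'; lra.
(* Follows from [n < 3 ^ n]; for large [n] it violates the Archimedean property. *)
have bound n : n%:R * (y' - x') <= 1.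
  have := @middle_third_step_gap n x' y' (fun z Mz => xyM z Mz n I).
  apply: le_trans; rewrite mulrC ler_wpM2l ?ltW//.
  by rewrite -natrX ltr_nat ltn_expl.
have := bound (Num.bound (y' - x')^-1).
apply/negP; rewrite -ltNge -ltr_pdivrMr// mul1r.
have := archi_boundP (ltW _ : 0 <= (y' - x')^-1); apply.
by rewrite invr_gt0.
Qed.

Lemma middle_third_step_closed n : closed (middle_third_step R n).
Proof.
elim: n => [|n ih] /=; first exact: itv_closed.
apply: closedU.
  have -> : [set x / 3 | x in middle_third_step R n] =
            (fun x => x * 3) @^-1` middle_third_step R n.
    apply/seteqP; split=> x /=; first by move=> [w wM <-]; rewrite divfK.
    by move=> xM; exists (x * 3) => //; rewrite mulfK.
  apply: preimage_closed ih => x _.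
  exact: mulrr_continuous.
have -> : [set (x + 2) / 3 | x in middle_third_step R n] =
          (fun x => x * 3 - 2) @^-1` middle_third_step R n.
  apply/seteqP; split=> x /=; first by move=> [w wM <-]; rewrite divfK// addrK.
  by move=> xM; exists (x * 3 - 2) => //; rewrite subrK mulfK.
apply: preimage_closed ih => x _.
by apply: cvgB; [exact: mulrr_continuous|exact: cvg_cst].
Qed.

Lemma middle_third_compact : compact (middle_third_set R).
Proof.
apply: (subclosed_compact _ (@segment_compact R 0 1)).
  by apply: closed_bigI => n _; exact: middle_third_step_closed.
by move=> x /(_ 0%N I).
Qed.

Lemma cantor_set_compact (C : set R) : cantor_set R C -> compact C.
Proof.
move=> [f [cf [g [cg fK gK]]]].
have -> : C = range (set_val \o g).
  apply/seteqP; split=> x.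
    by move=> Cx; exists (f (to_set_type Cx)) => //=; rewrite fK.
  by move=> [y _ <-] /=; exact: set_valP.
apply: continuous_compact; last first.
  exact: compact_set_type middle_third_compact.
apply: continuous_subspaceT => x; apply: continuous_comp; first exact: cg.
exact: set_val_continuous.
Qed.

(** An interval inside [C] would map continuously and injectively into the middle-third set. By the
    intermediate value theorem its image would fill an interval, contradicting the gaps of that
    set. *)
Lemma cantor_set_gapped (C : set R) : cantor_set R C -> gapped C.
Proof.
move=> [f [cf [g [cg fK gK]]]] x y xy; apply: contrapT => nq.
pose a := x + (y - x) / 3; pose b := x + (y - x) * 2 / 3.
have ab : a < b by rewrite /a /b; lra.
have abC : `[a, b] `<=` C.
  move=> z; rewrite /= in_itv/= /a /b => xzy; apply: contrapT => nz.
  by apply: nq; exists z => //; lra.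
have clC z : C (clamp a b z) by apply/abC/clamp_itv/ltW.
pose F := set_val \o f \o corestrict clC.
have cF : continuous F.
  move=> z; apply: continuous_comp.
    exact/continuous_corestrict/continuous_clamp.
  by apply: continuous_comp; [exact: cf|exact: set_val_continuous].
have Fab : F a <> F b.
  move=> /set_val_inj/(can_inj fK)/(congr1 set_val).
  by rewrite !corestrictE !clamp_id ?lexx ?ltW//; lra.
have [q qab nq'] : exists2 q,
    Num.min (F a) (F b) <= q <= Num.max (F a) (F b) & ~ middle_third_set R q.
  have [lt|lt|//] := ltgtP (F a) (F b).
    by have [q qab] := middle_third_gapped lt; exists q => //; lra.
  by have [q qab] := middle_third_gapped lt; exists q => //; lra.
have [c _ cq] := IVT (ltW ab) (continuous_subspaceT cF) qab.
by apply: nq'; rewrite -cq; exact: set_valP.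
Qed.

End Cantor_sets_of_reals.

(** * Sets of reals with gaps compared with the Cantor space *)

Section Cantor_spaces_of_reals.
Variable R : realType.

Lemma open_const (T : topologicalType) (P : Prop) : open [set _ : T | P].
Proof.
have [p|np] := pselect P.
  have -> : [set _ : T | P] = setT by apply/seteqP; split.
  exact: openT.
have -> : [set _ : T | P] = set0 by apply/seteqP; split.
exact: open0.
Qed.

(** Once [q] is missing, strict and weak comparison with [q] select the same points of [A]; the
    first gives an open set, the second a closed one. *)
Lemma gapped_cut_clopen (A : set R) (q : R) :
  ~ A q -> clopen [set z : A | set_val z < q].
Proof.
move=> Aq; split.
  apply: (@open_comp _ _ set_val [set z | z < q]); last exact: open_lt.
  by move=> z _; exact: set_val_continuous.
have -> : [set z : A | set_val z < q] = set_val @^-1` [set z | z <= q].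
  apply/seteqP; split=> z /=; first exact: ltW.
  rewrite le_eqVlt => /orP[/eqP zq|//]; exfalso; apply: Aq.
  by rewrite -zq; exact: set_valP.
apply: preimage_closed; last exact: closed_le.
by move=> z _; exact: set_val_continuous.
Qed.

(** The complement of [A] is open, so it contains rationals near any of its points. Countably many
    cuts thus suffice to separate the points of [A]. *)
Lemma gapped_rat (A : set R) (x y : R) : closed A -> gapped A -> x < y ->
  exists2 q : rat, x < ratr q < y & ~ A (ratr q).
Proof.
move=> cA gA xy; have [z /andP[xz zy] nz] := gA _ _ xy.
pose U := (~` A) `&` ([set z | x < z] `&` [set z | z < y]).
have oU : open U.
  apply: openI; first exact: closed_openC.
  by apply: openI; [exact: open_gt|exact: open_lt].
have [w [[nw [xw wy]] [q _ qw]]] :=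
  dense_rat (ex_intro U z (conj nz (conj xz zy))) oU.
by exists q; rewrite qw //; apply/andP.
Qed.

(* A point is encoded by the rationals outside A lying to its right. *)
Lemma gapped_injects_cantor_space (A : set R) : closed A -> gapped A ->
  exists2 i : A -> cantor_space, continuous i & injective i.
Proof.
(* The default 0 is harmless: the second conjunct of [i] makes a coordinate constant unless [r n] is
   missing from [A], so every coordinate is continuous whatever [r n] is. *)
move=> cA gA; pose r n : R := if unpickle n is Some q then ratr (q : rat) else 0.
pose i (x : A) : cantor_space := fun n => (set_val x < r n) && `[< ~ A (r n) >].
exists i.
  move=> x; apply/cvg_sup; first exact/fmap_filter/nbhs_filter.
  move=> n; move: x.
  apply/(@continuousP _ (initial_topology (@^~ n))) => B [D oD <-].
  have [Ar|nAr] := pselect (A (r n)).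
    have -> : i @^-1` (@^~ n @^-1` D) = [set _ | D false].
      by apply/seteqP; split=> z /=; rewrite /i asboolF ?andbF // => /(_ Ar).
    exact: open_const.
  have [oc cc] := gapped_cut_clopen nAr.
  have -> : i @^-1` (@^~ n @^-1` D) =
     ([set z : A | set_val z < r n] `&` [set _ | D true]) `|`
     (~` [set z : A | set_val z < r n] `&` [set _ | D false]).
    apply/seteqP; split=> z /=; rewrite /i (asboolT nAr) andbT.
      by case: (boolP (_ < _)) => [|/negP] zr Dz; [left|right].
    by move=> [[zr]|[/negP/negbTE zr]]; rewrite zr.
  by apply: openU; apply: openI; rewrite ?openC //; exact: open_const.
move=> x y xy; apply: set_val_inj.
wlog ltxy : x y xy / set_val x < set_val y.
  by move=> h; have [lt|lt|//] := ltgtP (set_val x) (set_val y);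
    [exact: h|apply/esym/h].
have [q /andP[xq qy] nq] := gapped_rat cA gA ltxy.
have := congr1 (fun f => f (pickle q)) xy.
by rewrite /i /r pickleK (asboolT nq) xq ltNge ltW.
Qed.

(** The approximation hypothesis excludes isolated points, and cutting at a missing point between
    two given points provides the clopen sets of zero-dimensionality. *)
Lemma gapped_cantor_like (A : set R) : compact A -> gapped A ->
  (forall x e : R, A x -> 0 < e -> exists y, [/\ A y, y != x & `|x - y| < e]) ->
  cantor_like A.
Proof.
move=> cA gA pA; split.
- apply/perfectTP => x [U oU Ux].
  have : nbhs (set_val x) U.
    by apply: open_nbhs_nbhs; split=> //; have : [set x] x by []; rewrite -Ux.
  move=> /nbhs_ballP[e e0 eU].
  have [y [Ay yx xye]] := pA _ _ (set_valP x) e0.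
  have : (set_val @^-1` U) (to_set_type Ay) by apply: eU.
  by rewrite Ux /= => /(congr1 set_val) yxE; move/eqP: yx; apply.
- exact: compact_set_type.
- exact/hausdorff_set_type/Rhausdorff.
- move=> x y xy; have := contra_neq (@set_val_inj _ _ _ _) xy.
  rewrite neq_lt => /orP[] /gA[q /andP[q1 q2] /gapped_cut_clopen cq].
    exists [set z : A | set_val z < q]; split=> //=.
    by apply/negP; rewrite -leNgt ltW.
  exists (~` [set z : A | set_val z < q]); split=> //=; first exact: clopenC set0 cq.
    by apply/negP; rewrite -leNgt ltW.
Qed.

Lemma cantor_like_parametrization (A : set R) : A !=set0 -> cantor_like A ->
  exists2 g : cantor_space -> A, continuous g & injective g.
Proof.
move=> [a Aa] cA.
(* The characterization of the Cantor space concerns pointed spaces; [a] serves as base point. *)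
pose T : pseudoPMetricType R :=
  HB.pack (set_type A) (isPointed.Build (set_type A) (to_set_type Aa)).
have [g [cg _]] := @homeomorphism_cantor_like R T cA.
by exists g => //; move=> x y; apply: inj; rewrite ?inE.
Qed.

End Cantor_spaces_of_reals.

Lemma continuous_pair (T U V : topologicalType) (f : T -> U) (g : T -> V) :
  continuous f -> continuous g -> continuous (fun x => (f x, g x)).
Proof. by move=> cf cg x; apply: cvg_pair; [exact: cf|exact: cg]. Qed.

(** * Legs of a planar fan and connected subsets of the fan *)

Section Legs.
Variable R : realType.

(** The point at parameter [t] on the segment from the vertex to [(c, -1)]. The depth [t] is read
    off the second coordinate, even at the vertex, where [c] is lost. *)
Definition leg (c t : R) : R * R := (t * c, - t).

Lemma fan_overP (C : set R) p :
  fan_over C p <-> exists c t, [/\ C c, 0 <= t <= 1 & p = leg c t].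
Proof.
split=> [[c Cc [t]]|[c [t [Cc t01 ->]]]].
  rewrite /= in_itv/= => t01 <-; exists c, t; split=> //.
  by rewrite /leg !mulr0 !add0r mulrN1.
exists c => //; exists t; first by rewrite /= in_itv.
by rewrite /leg /= !mulr0 !add0r mulrN1.
Qed.

Lemma leg_inj (c c' t t' : R) : leg c t = leg c' t' ->
  t = t' /\ (t != 0 -> c = c').
Proof.
by move=> [tc /oppr_inj tt]; split=> // t0; apply: (mulfI t0); rewrite tc tt.
Qed.

Lemma continuous_leg (T : topologicalType) (f g : T -> R) :
  continuous f -> continuous g -> continuous (fun x => leg (f x) (g x)).
Proof.
move=> cf cg; apply: continuous_pair => x.
  by apply: cvgM; [exact: cg|exact: cf].
by apply: cvgN; exact: cg.
Qed.

Lemma continuous_affine (a b d : R) :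
  continuous (fun p : R * R => a * p.1 + b * p.2 + d).
Proof.
move=> p; apply: cvgD; last exact: cvg_cst.
by apply: cvgD; (apply: cvgM; first exact: cvg_cst); [exact: cvg_fst|exact: cvg_snd].
Qed.

Lemma open_affine (a b d : R) : open [set p : R * R | 0 < a * p.1 + b * p.2 + d].
Proof.
apply: (@open_comp _ _ (fun p : R * R => a * p.1 + b * p.2 + d) [set x | 0 < x]);
  last exact: open_gt.
by move=> p _; exact: continuous_affine.
Qed.

Lemma closed_affine (a b d : R) :
  closed [set p : R * R | 0 <= a * p.1 + b * p.2 + d].
Proof.
apply: (@preimage_closed _ _ (fun p : R * R => a * p.1 + b * p.2 + d) [set x | 0 <= x]);
  last exact: closed_ge.
by move=> p _; exact: continuous_affine.
Qed.

(* Between two points of the complement of C close to c, the part of Z at depth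
   greater than s is clopen in Z. *)
Lemma connected_leg_gap (C : set R) (Z : set (R * R)) (c s t : R) :
  gapped C -> Z `<=` fan_over C -> closed Z -> connected Z ->
  0 <= s < t -> Z (leg c t) -> ~ Z (leg c s) ->
  forall p, Z p -> exists2 t', s < t' & p = leg c t'.
Proof.
move=> gC ZC cZ coZ /andP[s0 st] Zt nZs.
have [c0 [t0 [Cc0 /andP[t00 t01] /leg_inj[tt0]]]] := (fan_overP _ _).1 (ZC _ Zt).
have tn0 : t != 0 by rewrite gt_eqF //; lra.
move=> /(_ tn0) cc0; subst c0 t0.
have [d d0 dZ] : exists2 d, 0 < d & ball (leg c s) d `<=` ~` Z.
  by apply/nbhs_ballP/open_nbhs_nbhs; split=> //; exact: closed_openC.
have key e : 0 < e <= d -> forall p, Z p ->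
    exists c' t', [/\ s < t', `|c' - c| < e & p = leg c' t'].
  move=> /andP[e0 ed].
  have [q1 /andP[q1l q1r] nq1] : exists2 q, c - e < q < c & ~ C q by apply: gC; lra.
  have [q2 /andP[q2l q2r] nq2] : exists2 q, c < q < c + e & ~ C q by apply: gC; lra.
  pose B := Z `&` ([set p | 0 < 0 * p.1 + (-1) * p.2 + (- s)] `&`
    ([set p | 0 < 1 * p.1 + q1 * p.2 + 0] `&`
     [set p | 0 < (-1) * p.1 + (- q2) * p.2 + 0])).
  have BZ : B = Z.
    apply: coZ.
    - exists (leg c t); split=> //=; split; first by lra.
      have t0 : 0 < t by lra.
      by split; nra.
    - eexists; last by reflexivity.
      by repeat apply: openI; exact: open_affine.
    (* Weak inequalities select the same points of [Z]: the slopes [q1] and [q2] are missing from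
       [C], and points of the wedge at depth [s] fall in the ball that avoids [Z]. *)
    - exists ([set p | 0 <= 0 * p.1 + (-1) * p.2 + (- s)] `&`
        ([set p | 0 <= 1 * p.1 + q1 * p.2 + 0] `&`
         [set p | 0 <= (-1) * p.1 + (- q2) * p.2 + 0])).
        by repeat apply: closedI; exact: closed_affine.
      apply/seteqP; split=> p [Zp [/= h1 [/= h2 h3]]].
        by split=> //; split; [exact: ltW|split; exact: ltW].
      split=> //.
      have [c' [t' [Cc' /andP[t'0 t'1] pE]]] := (fan_overP _ _).1 (ZC _ Zp).
      move: h1 h2 h3; rewrite pE /= => h1 h2 h3.
      have st' : s <= t' by lra.
      have nq1' : c' != q1 by apply/eqP => E; apply: nq1; rewrite -E.
      have nq2' : c' != q2 by apply/eqP => E; apply: nq2; rewrite -E.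
      (* If [t'] is 0 then so is [s], and the slope inequalities say nothing; but [p] is then the
         vertex, which equals [leg c s]. *)
      have [t'eq|t'pos] := leP t' 0.
        exfalso; apply: (dZ p) => //; rewrite pE.
        have -> : t' = s by lra.
        have -> : leg c' s = leg c s by rewrite /leg (_ : s = 0) ?mul0r //; lra.
        exact: ballxx.
      have q1c' : q1 < c' by rewrite lt_neqAle eq_sym nq1' /=; nra.
      have c'q2 : c' < q2 by rewrite lt_neqAle nq2' /=; nra.
      have sn : s != t'.
        apply/eqP => E; apply: (dZ p) => //; rewrite pE -E.
        split; last exact: ballxx.
        rewrite /ball /= -mulrBr normrM ger0_norm //.
        have : `|c - c'| < d by rewrite ltr_norml; lra.
        have := normr_ge0 (c - c').
        by nra.
      have st2 : s < t' by rewrite lt_neqAle sn.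
      by split; [lra|split; nra].
  move=> p Zp; have : B p by rewrite BZ.
  move=> [_ [/= h1 [/= h2 h3]]].
  have [c' [t' [Cc' /andP[t'0 t'1] pE]]] := (fan_overP _ _).1 (ZC _ Zp).
  move: h1 h2 h3; rewrite pE /= => h1 h2 h3.
  exists c', t'; split=> //; first by lra.
  have t'p : 0 < t' by lra.
  have q1c' : q1 < c' by nra.
  have c'q2 : c' < q2 by nra.
  by rewrite ltr_norml; lra.
move=> p Zp.
have [c' [t' [Cc' /andP[t'0 t'1] pE]]] := (fan_overP _ _).1 (ZC _ Zp).
have [c1 [t1 [st1 _ pE1]]] := key d (introT andP (conj d0 (lexx d))) p Zp.
have [tt1 _] := leg_inj (etrans (esym pE) pE1).
exists t'; rewrite ?tt1 // pE.
have [->//|c'c] := eqVneq c' c; first by rewrite tt1.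
have e0 : 0 < `|c' - c| by rewrite normr_gt0 subr_eq0.
(* With [e] at most [|c' - c|], the leg of [p] would be closer to [c] than it is. *)
have [|c2 [t2 [st2 c2e pE2]]] := key (Num.min d `|c' - c|) _ p Zp.
  by rewrite lt_min d0 e0 ge_min lexx.
have [tt2 cc2] := leg_inj (etrans (esym pE) pE2).
have t'0' : t' != 0 by rewrite gt_eqF //; lra.
by move: c2e; rewrite -(cc2 t'0') lt_min ltxx andbF.
Qed.

(** A missing point in between would, by [connected_leg_gap], force all of [Z] to lie deeper than
    it, which fails for [leg c t1]. *)
Lemma connected_leg_convex (C : set R) (Z : set (R * R)) (c t1 s t2 : R) :
  gapped C -> Z `<=` fan_over C -> closed Z -> connected Z ->
  Z (leg c t1) -> Z (leg c t2) -> 0 <= s -> t1 <= s <= t2 -> Z (leg c s).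
Proof.
move=> gC ZC cZ coZ Z1 Z2 s0 /andP[]; rewrite le_eqVlt => /orP[/eqP<-//|t1s].
rewrite le_eqVlt => /orP[/eqP->//|st2]; apply: contrapT => nZ.
have s0t2 : 0 <= s < t2 by rewrite s0.
have [t' st' /leg_inj[tt' _]] := connected_leg_gap gC ZC cZ coZ s0t2 Z2 nZ Z1.
by lra.
Qed.

End Legs.

(** * End-points cannot lie inside a leg *)

Section End_points.
Variable R : realType.

Lemma unit_interval_compact : compact [set: unit_interval R].
Proof. exact/compact_set_type/segment_compact. Qed.

Lemma unit_intervalP (s : unit_interval R) : 0 <= set_val s <= 1.
Proof. by have := set_valP s; rewrite /unit_interval /= in_itv. Qed.

(** The part of the leg between depths [t1] and [t2] is an arc through [x]. Along any
    parametrization of it the depth is continuous and injective, so it takes the value [t] strictly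
    between the parameters of [t1] and [t2], hence neither at 0 nor at 1. *)
Lemma end_point_leg (S : topologicalType) (e : S -> R * R) (x : S)
    (c t1 t t2 : R) :
  compact [set: S] -> continuous e -> injective e ->
  (forall s, t1 <= s <= t2 -> range e (leg c s)) ->
  end_points R S x -> e x = leg c t -> t1 < t < t2 -> False.
Proof.
move=> cS ce eI legZ epx ext /andP[t1t tt2].
have hR : hausdorff_space (R * R)%type by exact: (@norm_hausdorff _ (R * R)%type).
have hS : hausdorff_space S := hausdorff_injective hR ce eI.
have [_ [h [hE [ch [g [cg hK gK]]]]]] := compact_injective_embedding cS hR ce eI.
pose u (s : unit_interval R) := t1 + set_val s * (t2 - t1).
have uZ s : range e (leg c (u s)).
  by apply: legZ; have := unit_intervalP s; rewrite /u; nra.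
have cu : continuous u.
  move=> s; apply: (@continuous_comp (unit_interval R) R R set_val
    (fun z => t1 + z * (t2 - t1)) s).
    exact: set_val_continuous.
  by apply: cvgD; [exact: cvg_cst|exact: mulrr_continuous].
(* The straight segment, pulled back to [S] through the inverse of [e] on its range. *)
pose gam := g \o corestrict uZ.
have egam s : e (gam s) = leg c (u s) by rewrite -hE /gam /= gK.
have cgam : continuous gam.
  move=> s; apply: continuous_comp; last exact: cg.
  apply: continuous_corestrict.
  exact: (continuous_leg (@cst_continuous _ _ c) cu).
have gamI : injective gam.
  move=> s s' /(congr1 e); rewrite !egam => /leg_inj[uu _].
  apply: set_val_inj; apply: (@mulIf _ (t2 - t1)).
    by rewrite gt_eqF //; lra.
  exact: (addrI t1).
have [_ [k [_ hk]]] :=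
  compact_injective_embedding unit_interval_compact hS cgam gamI.
have gam_at t' : t1 <= t' <= t2 -> exists2 y, range gam y & e y = leg c t'.
  move=> tt'.
  have s01 : (unit_interval R) ((t' - t1) / (t2 - t1)).
    rewrite /unit_interval /= in_itv /= ler_pdivlMr ?ler_pdivrMr; lra.
  exists (gam (to_set_type s01)); first by exists (to_set_type s01).
  rewrite egam /u; congr leg.
  have d0 : t2 - t1 != 0 by rewrite gt_eqF //; lra.
  by rewrite /= divfK //; lra.
have gx : range gam x.
  have [|y gy ey] := gam_at t; first by lra.
  by have -> : x = y by apply: eI; rewrite ext.
have [h' [[ch' [g' [_ h'K g'K]]] [t0 [t0E h't0]]]] :=
  epx _ (ex_intro _ k hk) gx.
have clU z : (unit_interval R) (clamp 0 1 z) by exact: clamp_itv.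
(* Depth along the parametrization [h'] that has [x] at one end, extended to the whole line. *)
pose psi z := - (e (set_val (h' (corestrict clU z)))).2.
have cpsi : continuous psi.
  move=> z; apply: cvgN.
  apply: (@continuous_comp _ _ _ (fun z => e (set_val (h' (corestrict clU z)))) snd);
    last exact: cvg_snd.
  apply: continuous_comp; last exact: ce.
  apply: continuous_comp; last exact: set_val_continuous.
  apply: continuous_comp; last exact: ch'.
  exact/continuous_corestrict/continuous_clamp.
have psiE (s : unit_interval R) : psi (set_val s) = - (e (set_val (h' s))).2.
  rewrite /psi; do 5 congr (_ _).
  by apply: set_val_inj; rewrite corestrictE clamp_id // unit_intervalP.
have psiI (s s' : unit_interval R) : psi (set_val s) = psi (set_val s') -> s = s'.
  rewrite !psiE => /oppr_inj E; apply: (can_inj h'K); apply: set_val_inj.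
  have [z zs] := range_set_val (h' s); have [z' zs'] := range_set_val (h' s').
  move: E; rewrite -zs -zs' !egam => /oppr_inj uu.
  by apply: eI; rewrite !egam uu.
have psi_at t' : t1 <= t' <= t2 -> exists s : unit_interval R, psi (set_val s) = t'.
  move=> /gam_at[y gy ey]; exists (g' (to_set_type gy)).
  by rewrite psiE g'K /= ey /= opprK.
have psit0 : psi (set_val t0) = t by rewrite psiE h't0 ext /= opprK.
have [|s1 s1E] := psi_at t1; first by lra.
have [|s2 s2E] := psi_at t2; first by lra.
have s1n : set_val s1 != set_val t0.
  by apply/eqP => /set_val_inj E; move: s1E; rewrite E psit0; lra.
have s2n : set_val s2 != set_val t0.
  by apply/eqP => /set_val_inj E; move: s2E; rewrite E psit0; lra.
(* As [t0] is 0 or 1, an interval inside [[0, 1]] whose ends differ from [t0] misses it, and by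
   injectivity [psi] takes the value [t] only at [t0]. *)
have fin a b v : a <= b -> 0 <= a -> b <= 1 -> a != set_val t0 ->
    b != set_val t0 -> Num.min (psi a) (psi b) <= v <= Num.max (psi a) (psi b) ->
    v <> t.
  move=> ab a0 b1 an bn /(IVT ab (continuous_subspaceT cpsi))[z].
  rewrite in_itv /= => azb <- zt.
  have zU : (unit_interval R) z by rewrite /unit_interval /= in_itv /=; lra.
  have E : z = set_val t0 :=
    congr1 set_val (psiI (to_set_type zU) t0 (etrans zt (esym psit0))).
  have t0z : z = 0 \/ z = 1 by rewrite E.
  by case: t0z => z01; [move/eqP: an|move/eqP: bn]; rewrite -E; apply; lra.
have s1U := unit_intervalP s1; have s2U := unit_intervalP s2.
have [le12|/ltW le21] := leP (set_val s1) (set_val s2).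
  by apply: (fin _ _ t le12) => //; [lra|lra|];
    rewrite s1E s2E ge_min le_max (ltW t1t) (ltW tt2) ?orbT.
by apply: (fin _ _ t le21) => //; [lra|lra|];
  rewrite s1E s2E ge_min le_max (ltW t1t) (ltW tt2) ?orbT.
Qed.

End End_points.

(** * From dense end-points to a Cantor set of long legs *)

Section Dense_end_points.
Variable R : realType.

Lemma gapped_subset (A B : set R) : A `<=` B -> gapped B -> gapped A.
Proof. by move=> AB gB x y /gB[q xqy nq]; exists q => // /AB. Qed.

(** End-points are taken in the space [S], while legs are traced in the plane by its copy [range e],
    the set [Z] of the preceding lemmas. *)
Lemma dense_end_points_cantor_legs (S : topologicalType) (e : S -> R * R)
    (C : set R) :
  C `<=` `[0, 1] -> closed C -> gapped C -> compact [set: S] ->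
  continuous e -> injective e -> connected (range e) ->
  range e `<=` fan_over C -> (exists x y : S, x <> y) ->
  closure (end_points R S) = [set: S] ->
  exists (A : set R) (d : R), [/\ A !=set0, A `<=` `[0, 1], cantor_like A, 0 < d &
    forall a t, A a -> 0 <= t <= d -> range e (leg a t)].
Proof.
move=> C01 cC gC cS ce eI coZ ZC [x0 [y0 xy0]] clE.
have hR : hausdorff_space (R * R)%type by exact: (@norm_hausdorff _ (R * R)%type).
have cZ : closed (range e).
  apply: compact_closed => //; apply: continuous_compact => //.
  exact: continuous_subspaceT.
have convex := connected_leg_convex gC ZC cZ coZ.
have C01' c : C c -> 0 <= c <= 1 by move=> /C01; rewrite /= in_itv.
have legP p : range e p -> exists c t, [/\ 0 <= c <= 1, 0 <= t <= 1 & p = leg c t].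
  by move=> /ZC /fan_overP[c [t [Cc t01 ->]]]; exists c, t; split=> //; exact: C01'.
have legC c t : 0 < t -> range e (leg c t) -> C c.
  move=> t0 /ZC /fan_overP[c' [t' [Cc' _ /leg_inj[_ ->//]]]].
  by rewrite gt_eqF.
have no_end x c t1 t t2 : end_points R S x -> e x = leg c t -> 0 <= t1 ->
    t1 < t < t2 -> range e (leg c t1) -> range e (leg c t2) -> False.
  move=> epx ext t10 tt Z1 Z2; apply: (end_point_leg cS ce eI _ epx ext tt).
  by move=> s st; apply: (convex _ t1 _ t2) => //; lra.
have near_end c t r : range e (leg c t) -> 0 < r ->
    exists x c' t', [/\ end_points R S x, e x = leg c' t', 0 <= c' <= 1 &
      [/\ 0 <= t' <= 1, `|t - t'| < r & `|t * c - t' * c'| < r]].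
  move=> [y _ eyt] r0.
  have : closure (end_points R S) y by rewrite clE.
  have : nbhs y (e @^-1` ball (leg c t) r).
    by apply: ce; rewrite eyt; exact: nbhsx_ballx.
  move=> Ny /(_ _ Ny)[x [epx bx]].
  have [c' [t' [c'01 t'01 ext]]] := legP (e x) (ex_intro2 _ _ x I erefl).
  exists x, c', t'; split=> //; move: bx; rewrite /= ext => -[/= b1 b2].
  split=> //; move: b2; rewrite /ball /= -opprB opprK -normrN.
  by congr (`|_| < _); ring.
(* Without the vertex, [connected_leg_gap] at depth 0 would confine [range e] to one leg. It has two
   points there, and an end-point near their midpoint would lie inside the leg. *)
have Z0 : range e (leg 0 0).
  apply: contrapT => nZ0.
  have leg00 c : leg c 0 = leg 0 0 :> R * R by rewrite /leg !mul0r.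
  have [c1 [t1 [c1b t1b ext1]]] := legP (e x0) (ex_intro2 _ _ x0 I erefl).
  have Z1 : range e (leg c1 t1) by exists x0.
  have t1p : 0 < t1.
    rewrite ltNge; apply/negP => t1le.
    have t10 : t1 = 0 by lra.
    by apply: nZ0; move: Z1; rewrite t10 leg00.
  have nZ0' : ~ range e (leg c1 0) by rewrite leg00.
  have onleg := connected_leg_gap gC ZC cZ coZ
    (introT andP (conj (lexx 0) t1p)) Z1 nZ0'.
  have [t2 t2p ext2] := onleg (e y0) (ex_intro2 _ _ y0 I erefl).
  have Z2 : range e (leg c1 t2) by exists y0.
  have t12 : t1 != t2.
    by apply/eqP => E; apply: xy0; apply: eI; rewrite ext1 ext2 E.
  have main u v : 0 < u < v -> range e (leg c1 u) -> range e (leg c1 v) -> False.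
    move=> uv Zu Zv.
    have Zm : range e (leg c1 ((u + v) / 2)) by apply: (convex _ u _ v) => //; lra.
    have r0 : 0 < (v - u) / 2 by lra.
    have [x [c' [t' [epx ext _ [_ tr _]]]]] := near_end _ _ _ Zm r0.
    have [t'' _ E] := onleg (e x) (ex_intro2 _ _ x I erefl).
    have [tt _] := leg_inj (etrans (esym ext) E).
    move: tr; rewrite ltr_norml => tr.
    by apply: (no_end x c1 u t'' v) => //; lra.
  move: t12; rewrite neq_lt => /orP[t12|t12].
    by apply: (main t1 t2) => //; lra.
  by apply: (main t2 t1) => //; lra.
have Zc0 c : range e (leg c 0) by move: Z0; rewrite /leg !mul0r.
have [c0 [t0 [t0p Z00]]] : exists c t, 0 < t /\ range e (leg c t).
  have [c1 [t1 [_ t1b ext1]]] := legP (e x0) (ex_intro2 _ _ x0 I erefl).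
  have [c2 [t2 [_ t2b ext2]]] := legP (e y0) (ex_intro2 _ _ y0 I erefl).
  have [t1p|t1p] := ltP 0 t1; first by exists c1, t1; split=> //; exists x0.
  have [t2p|t2p] := ltP 0 t2; first by exists c2, t2; split=> //; exists y0.
  exfalso; apply: xy0; apply: eI; rewrite ext1 ext2.
  have t10 : t1 = 0 by lra.
  have t20 : t2 = 0 by lra.
  by rewrite t10 t20 /leg !mul0r.
(* Half of a depth that is reached, so that the leg of [c0] goes strictly beyond [d] and [P] is
   non-empty. *)
pose d := t0 / 2; have d0 : 0 < d by rewrite /d; lra.
pose P := [set c | exists2 t, d < t & range e (leg c t)].
pose D := [set c | range e (leg c d)].
have PD : P `<=` D.
  by move=> c [t dt Zt]; apply: (convex _ 0 _ t) => //; lra.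
have cD : closed D.
  apply: (@preimage_closed _ _ (fun c => leg c d) (range e)) => // c _.
  by apply: continuous_leg; [move=> x; exact: cvg_id|exact: cst_continuous].
(* Limits of slopes in [P] need not lie in [P], but their legs still reach depth [d]. *)
have AD : closure P `<=` D by rewrite (closure_id D).1 //; exact: closureS.
have AC : closure P `<=` C by move=> c /AD; exact: legC.
exists (closure P), d; split=> //.
- by exists c0; apply: subset_closure; exists t0 => //; rewrite /d; lra.
- exact: subset_trans AC C01.
- apply: gapped_cantor_like.
  + apply: (subclosed_compact _ (@segment_compact R 0 1)).
      exact: closed_closure.
    exact: subset_trans AC C01.
  + exact: gapped_subset AC gC.
  + move=> a r Aa r0.
    have [b [Pb abr]] := Aa _ (nbhsx_ballx a r r0).
    (* If the approximating point of [P] is [a] itself, density of end-points has to supply another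
       one. *)
    have [ba|ba] := eqVneq b a; last first.
      by exists b; split=> //; exact: subset_closure.
    subst b; case: Pb => t dt Zt.
    pose s := (d + t) / 2; have dst : d < s < t by rewrite /s; lra.
    have Zs : range e (leg a s) by apply: (convex _ 0 _ t) => //; lra.
    (* The first bound keeps the depth [t'] of the nearby end-point between [d] and [t], which puts
       [c'] in [P] and excludes [c' = a]. The second one gives [|a - c'| < r], after division by
       [s], because [c'] is at most 1. *)
    pose r' := Num.min ((t - d) / 2) (s * r / 3).
    have r'0 : 0 < r' by rewrite lt_min; apply/andP; split; nra.
    have [x [c' [t' [epx ext c'01 [t'01 tr cr]]]]] := near_end _ _ _ Zs r'0.
    move: tr cr; rewrite !lt_min !ltr_norml => /andP[tr1 tr2] /andP[_ cr].
    have dt't : d < t' < t by rewrite /s in tr1; lra.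
    exists c'; split.
    * by apply: subset_closure; exists t'; [lra|rewrite -ext; exists x].
    * apply/eqP => E; subst c'.
      by apply: (no_end x a 0 t' t) => //; lra.
    * rewrite ltr_norml.
      have -> : a - c' = (s * a - t' * c' - (s - t') * c') / s.
        field; rewrite gt_eqF //; lra.
      have sp : 0 < s by lra.
      by rewrite ltr_pdivlMr // ltr_pdivrMr //; nra.
- by move=> a t Aa td; apply: (convex _ 0 _ d) => //; [exact: AD|lra].
Qed.

End Dense_end_points.

(** * Maps between fans induced by maps of slopes *)

Section Fan_embedding.
Variable R : realType.

(** Tietze extension: it provides a map of slopes on the whole line, to be fed to [fan_map]. The
    value 0 that [valL_] takes outside [A] is discarded. *)
Lemma continuous_set_type_extension (A : set R) (f : A -> R) (M : R) :
  closed A -> 0 < M -> continuous f -> (forall x, `|f x| <= M) ->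
  exists g : R -> R, [/\ continuous g, forall x, `|g x| <= M &
    forall x, g (set_val x) = f x].
Proof.
move=> cA M0 cf fM.
have fE x : valL_ 0 f (set_val x) = f x := congr1 (@^~ x) (valLK 0 f).
have vM x : A x -> `|valL_ 0 f x| <= M.
  by move=> Ax; have := fM (to_set_type Ax); rewrite -fE.
have cv := (@subspace_valL_continuousP' _ A _ 0 f).2 cf.
have [g [gf cg gM]] :=
  continuous_bounded_extension (@pseudometric_normal R R) cA M0 cv vM.
exists g; split=> // x; rewrite -fE -gf // inE; exact: set_valP.
Qed.

(* At the vertex the slope p.1 / - p.2 is the junk value 0, which is harmless
   because it gets multiplied by 0. *)
Definition fan_map (J : R -> R) (d : R) (p : R * R) : R * R :=
  leg (J (p.1 / - p.2)) (d * - p.2).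

Lemma fan_map_leg (J : R -> R) (d c t : R) :
  fan_map J d (leg c t) = leg (J c) (d * t).
Proof.
rewrite /fan_map /= opprK; have [->|t0] := eqVneq t 0.
  by rewrite mulr0 /leg !mul0r.
by rewrite mulrC mulKf.
Qed.

(** Where the second coordinate vanishes the slope has no limit, but [J] stays bounded and its
    factor tends to 0, so a squeeze applies. *)
Lemma continuous_fan_map (J : R -> R) (d M : R) :
  continuous J -> (forall x, `|J x| <= M) -> continuous (fan_map J d).
Proof.
move=> cJ JM.
have c2 : continuous (fun p : R * R => d * - p.2).
  move=> p; apply: cvgM; first exact: cvg_cst.
  by apply: cvgN; exact: cvg_snd.
apply: continuous_pair; last by move=> p; apply: cvgN; exact: c2.
move=> p; have [p20|p20] := eqVneq p.2 0; last first.
  apply: cvgM; first exact: c2.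
  apply: (@continuous_comp _ _ _ (fun p : R * R => p.1 / - p.2) J); last exact: cJ.
  apply: cvgM; first exact: cvg_fst.
  apply: cvgV; first by rewrite oppr_eq0.
  by apply: cvgN; exact: cvg_snd.
rewrite /continuous_at p20 oppr0 mulr0 mul0r.
have bound q : `|d * - q.2 * J (q.1 / - q.2)| <= `|d * - q.2| * M.
  by rewrite normrM ler_wpM2l.
apply/norm_cvg0P.
apply: (@squeeze_cvgr _ _ _ _ (fun=> 0) (fun q => `|d * - q.2| * M)).
- by apply: nearW => q; rewrite normr_ge0 bound.
- exact: cvg_cst.
have -> : 0 = `|d * - p.2| * M by rewrite p20 oppr0 mulr0 normr0 mul0r.
apply: cvgM; last exact: cvg_cst.
by apply: cvg_norm; exact: c2.
Qed.

End Fan_embedding.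

Theorem theorem3p1 (R : realType) (X L : metricType R)
  (hX : cantor_fan X) (hL : lelek_fan L) :
  exists f : X -> L, embedding f.
Proof.
case: hX => -[_ cptX _] [C1 [_ hC1 [h1 h1h]]].
case: hL => _ [X2 [Y [[_ [C2 [C2b hC2 [h2 h2h]]]] lelekY [k kh]]]].
case: lelekY => -[_ cY coY] [x [y [Yx Yy xy]]] clY.
have ch1 := h1h.1; have ch2 := h2h.1.
(* [Y], and with it [L], is copied into the plane through the ambient fan over [C2]. *)
pose E := set_val \o h2; pose e : Y -> R * R := E \o set_val.
have cE : continuous E.
  by move=> z; apply: continuous_comp; [exact: ch2|exact: set_val_continuous].
have EI : injective E by move=> u v /set_val_inj /(homeomorphism_injective h2h).
have ce : continuous e.
  by move=> z; apply: continuous_comp; [exact: set_val_continuous|exact: cE].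
have eI : injective e by move=> u v /EI /set_val_inj.
have rE : range e = E @` Y.
  apply/seteqP; split=> p /= [z].
    by move=> _ <-; exists (set_val z) => //; exact: set_valP.
  by move=> Yz <-; exists (to_set_type Yz).
have cS := compact_set_type cY.
have [|||A [d [A0 A01 cA d0 Ad]]] := dense_end_points_cantor_legs C2b
    (compact_closed (@Rhausdorff R) (cantor_set_compact hC2))
    (cantor_set_gapped hC2) cS ce eI _ _ _ clY.
- rewrite rE; apply: connected_continuous_connected => //.
  exact: continuous_subspaceT.
- by move=> p [z _ <-]; exact: set_valP.
- by exists (to_set_type Yx), (to_set_type Yy) => /(congr1 set_val).
have cC1 := compact_closed (@Rhausdorff R) (cantor_set_compact hC1).
(* The slopes in [C1] are injected into [A] by way of the Cantor space; [J] below extends this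
   injection to the line. *)
have [i ci iI] := gapped_injects_cantor_space cC1 (cantor_set_gapped hC1).
have [g cg gI] := cantor_like_parametrization A0 cA.
have j01 z : 0 <= set_val (g (i z)) <= 1.
  by have := A01 _ (set_valP (g (i z))); rewrite /= in_itv.
have [|z|J [cJ JM JE]] :=
  @continuous_set_type_extension R C1 (set_val \o g \o i) 1 cC1 ltr01.
- move=> z; apply: continuous_comp; first exact: ci.
  by apply: continuous_comp; [exact: cg|exact: set_val_continuous].
- by rewrite /= ger0_norm; have := j01 z; lra.
(* Slopes move by [J] into [A] and depths are scaled by [d], so [Ad] keeps the image inside
   [range e]. *)
pose F := fan_map J d \o set_val \o h1.
have fanX z : exists (c : C1) t, 0 <= t <= 1 /\ set_val (h1 z) = leg (set_val c) t.
  have /fan_overP[c [t [Cc t01 E1]]] := set_valP (h1 z).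
  by exists (to_set_type Cc), t.
have Fr z : range e (F z).
  have [c [t [t01 zE]]] := fanX z.
  by rewrite /F /= zE fan_map_leg JE; apply: Ad; [exact: set_valP|nra].
have cF : continuous F.
  move=> z; apply: continuous_comp; first exact: ch1.
  apply: continuous_comp; first exact: set_val_continuous.
  exact: continuous_fan_map cJ JM _.
have FI : injective F.
  move=> u v; have [c [t [t01 uE]]] := fanX u; have [c' [t' [t'01 vE]]] := fanX v.
  rewrite /F /= uE vE !fan_map_leg !JE => /leg_inj[tt cc].
  have tt' : t = t' by apply: (mulfI (lt0r_neq0 d0)).
  apply: (homeomorphism_injective h1h); apply: set_val_inj; rewrite uE vE -tt'.
  (* At depth 0 both points are the vertex; at any other depth the slopes are determined and
     injectivity on slopes applies. *)
  have [->|t0] := eqVneq t 0; first by rewrite /leg !mul0r.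
  congr leg; congr set_val; apply/iI/gI/set_val_inj/cc.
  by rewrite mulf_neq0 // lt0r_neq0.
have hR : hausdorff_space (R * R)%type by exact: (@norm_hausdorff _ (R * R)%type).
have [_ [h [hE [_ [h' [ch' _ h'K]]]]]] := compact_injective_embedding cS hR ce eI.
have [ck [k' [ck' kK k'K]]] := kh.
(* Back from the plane to [Y] by the inverse of [e], then to [L]. *)
exists (k' \o h' \o corestrict Fr); apply: compact_injective_embedding => //.
- exact: metric_hausdorff.
- move=> z; apply: continuous_comp; first exact/continuous_corestrict.
  by apply: continuous_comp; [exact: ch'|exact: ck'].
- by move=> u v /(can_inj k'K)/(can_inj h'K)/(congr1 set_val) /FI.
Qed.
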